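(* Every $\mathsf{CSGL}$ proof of a tree sequent of the form $\vdash x:\phi$ can be transformed into an end-active $\mathsf{CSGL}$ proof of $\vdash x:\phi$.
   Context: Formulae: $\phi ::= p \mid \neg\phi \mid \phi\lor\phi \mid \Box\phi$. Fix a countably infinite set of labels $x,y,z,\dots$. A relational atom is $xRy$; a labeled formula is $x:\phi$. A set $\mathcal{T}$ of relational atoms is a tree if the directed graph with vertices its labels and edges $(x,y)$ for $xRy\in\mathcal{T}$ is a tree. A tree sequent is $\mathcal{T},\Gamma\vdash\Delta$ with $\mathcal{T}$ a tree, $\Gamma,\Delta$ finite multisets of labeled formulae, such that if $\mathcal{T}\neq\emptyset$ every label of $\Gamma,\Delta$ occurs in $\mathcal{T}$, and if $\mathcal{T}=\emptyset$ all formulae in $\Gamma,\Delta$ share one label. A label is a leaf if it is a leaf of $\mathcal{T}$ (or the unique label if $\mathcal{T}=\emptyset$); a label $x$ is a pre-leaf if every $y$ with $xRy\in\mathcal{T}$ is a leaf. $\mathsf{CSGL}$ operates on tree sequents with rules (premises before $\Rightarrow$): $\mathsf{id_1}$: $\Rightarrow\mathcal{T},\Gamma,x:p\vdash x:p,\Delta$; $\mathsf{id_2}$: $\Rightarrow\mathcal{T},\Gamma,x:\Box\phi\vdash x:\Box\phi,\Delta$; $\neg\mathsf{L}$: $\mathcal{T},\Gamma\vdash x:\phi,\Delta\Rightarrow\mathcal{T},\Gamma,x:\neg\phi\vdash\Delta$; $\neg\mathsf{R}$: $\mathcal{T},\Gamma,x:\phi\vdash\Delta\Rightarrow\mathcal{T},\Gamma\vdash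 x:\neg\phi,\Delta$; $\lor\mathsf{L}$: $\mathcal{T},\Gamma,x:\phi\vdash\Delta$ and $\mathcal{T},\Gamma,x:\psi\vdash\Delta\Rightarrow\mathcal{T},\Gamma,x:\phi\lor\psi\vdash\Delta$; $\lor\mathsf{R}$: $\mathcal{T},\Gamma\vdash x:\phi,x:\psi,\Delta\Rightarrow\mathcal{T},\Gamma\vdash x:\phi\lor\psi,\Delta$; $\Box\mathsf{L}$: $\mathcal{T},xRy,\Gamma,x:\Box\phi,y:\phi\vdash\Delta\Rightarrow\mathcal{T},xRy,\Gamma,x:\Box\phi\vdash\Delta$; $\mathsf{4L}$: $\mathcal{T},xRy,\Gamma,x:\Box\phi,y:\Box\phi\vdash\Delta\Rightarrow\mathcal{T},xRy,\Gamma,x:\Box\phi\vdash\Delta$; $\Box\mathsf{R}$: $\mathcal{T},xRy,\Gamma,y:\Box\phi\vdash y:\phi,\Delta\Rightarrow\mathcal{T},\Gamma\vdash x:\Box\phi,\Delta$, provided $y$ does not occur in the conclusion. A proof is a finite tree of tree sequents built by these rules with all leaves conclusions of $\mathsf{id_1}$ or $\mathsf{id_2}$. Local rules: $\neg\mathsf{L},\neg\mathsf{R},\lor\mathsf{L},\lor\mathsf{R}$; propagation rules: $\Box\mathsf{L},\mathsf{4L}$. The principal label is the label $x$ of the principal formula in the conclusion; for $\Box\mathsf{L},\mathsf{4L}$ the auxiliary label is $y$. A proof is end-active if: (1) the principal label of every $\mathsf{id_1}$, $\mathsf{id_2}$ instance is a leaf; (2) the principal label of every local rule instance is a leaf; (3)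 in every propagation rule instance the principal label is a pre-leaf and the auxiliary label is a leaf (no condition on $\Box\mathsf{R}$). *)

(* Defs.v *)
From HB Require Import structures.
From mathcomp Require Import all_boot.
From mathcomp Require Import finmap multiset.

Set Implicit Arguments.
Unset Strict Implicit.
Unset Printing Implicit Defensive.

Local Open Scope fset_scope.
Local Open Scope mset_scope.

Inductive form : Type :=
| Var of nat
| Neg of form
| Or of form & form
| Box of form.

(* Multisets need a choiceType of elements; [form] gets one by encoding it
   into generic trees. *)
Fixpoint form_encode (phi : form) : GenTree.tree nat :=
  match phi with
  | Var p => GenTree.Leaf p
  | Neg a => GenTree.Node 0 [:: form_encode a]
  | Or a b => GenTree.Node 1 [:: form_encode a; form_encode b]
  | Box a => GenTree.Node 2 [:: form_encode a]
  end.

Fixpoint form_decode (t : GenTree.tree nat) : option form :=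
  match t with
  | GenTree.Leaf p => Some (Var p)
  | GenTree.Node 0 [:: a] => omap Neg (form_decode a)
  | GenTree.Node 1 [:: a; b] =>
      obind (fun a' => omap (Or a') (form_decode b)) (form_decode a)
  | GenTree.Node 2 [:: a] => omap Box (form_decode a)
  | _ => None
  end.

Lemma form_encodeK : pcancel form_encode form_decode.
Proof. by elim=> //= [a ->|a -> b ->|a ->]. Qed.

HB.instance Definition _ := Countable.copy form (pcan_type form_encodeK).

Notation label := nat.

(* The pair (x, y) stands for the relational atom xRy. *)
Notation relatom := (label * label)%type.

(* The pair (x, phi) stands for the labeled formula x : phi. *)
Notation lform := (label * form)%type.

Record sequent := Sequent {
  rels : {fset relatom};
  antec : {mset lform};
  succed : {mset lform}
}.

Definition edge (T : {fset relatom}) : rel label := fun x y => (x, y) \in T.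

Definition vertex (T : {fset relatom}) (x : label) : Prop :=
  exists y, edge T x y \/ edge T y x.

(* Rooted trees with edges directed away from the root: each vertex is reached
   from the root by exactly one directed path. The empty set of relational
   atoms is admitted, as in the definition of tree sequents. *)
Definition is_tree (T : {fset relatom}) : Prop :=
  T = fset0 \/
  exists2 r, vertex T r &
    forall v, vertex T v -> exists! p : seq label, path (edge T) r p /\ last r p = v.

Definition formula_label (S : sequent) (x : label) : Prop :=
  exists phi : form, (x, phi) \in antec S \/ (x, phi) \in succed S.

Definition occurs (x : label) (S : sequent) : Prop :=
  vertex (rels S) x \/ formula_label S x.

Definition tree_sequent (S : sequent) : Prop :=
  [/\ is_tree (rels S),
      rels S <> fset0 -> forall x, formula_label S x -> vertex (rels S) x
    & rels S = fset0 ->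
        forall x y, formula_label S x -> formula_label S y -> x = y].

(* In a tree sequent, if [rels S] is empty then every label occurring in [S] is
   its unique label, so this covers that case as well. *)
Definition leaf (S : sequent) (x : label) : Prop :=
  occurs x S /\ forall y, ~~ edge (rels S) x y.

Definition preleaf (S : sequent) (x : label) : Prop :=
  occurs x S /\ forall y, edge (rels S) x y -> leaf S y.

(* Every constructor requires its conclusion to be a tree sequent; as each
   premise is the conclusion of a further rule instance, all the sequents of a
   proof are tree sequents. *)
Inductive CSGL : sequent -> Type :=
| Id1 T G D x p :
    tree_sequent (Sequent T ((x, Var p) +` G) ((x, Var p) +` D)) ->
    CSGL (Sequent T ((x, Var p) +` G) ((x, Var p) +` D))
| Id2 T G D x phi :
    tree_sequent (Sequent T ((x, Box phi) +` G) ((x, Box phi) +` D)) ->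
    CSGL (Sequent T ((x, Box phi) +` G) ((x, Box phi) +` D))
| NegL T G D x phi :
    tree_sequent (Sequent T ((x, Neg phi) +` G) D) ->
    CSGL (Sequent T G ((x, phi) +` D)) ->
    CSGL (Sequent T ((x, Neg phi) +` G) D)
| NegR T G D x phi :
    tree_sequent (Sequent T G ((x, Neg phi) +` D)) ->
    CSGL (Sequent T ((x, phi) +` G) D) ->
    CSGL (Sequent T G ((x, Neg phi) +` D))
| OrL T G D x phi psi :
    tree_sequent (Sequent T ((x, Or phi psi) +` G) D) ->
    CSGL (Sequent T ((x, phi) +` G) D) ->
    CSGL (Sequent T ((x, psi) +` G) D) ->
    CSGL (Sequent T ((x, Or phi psi) +` G) D)
| OrR T G D x phi psi :
    tree_sequent (Sequent T G ((x, Or phi psi) +` D)) ->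
    CSGL (Sequent T G ((x, phi) +` ((x, psi) +` D))) ->
    CSGL (Sequent T G ((x, Or phi psi) +` D))
| BoxL T G D x y phi :
    tree_sequent (Sequent ((x, y) |` T)%fset ((x, Box phi) +` G) D) ->
    CSGL (Sequent ((x, y) |` T)%fset ((x, Box phi) +` ((y, phi) +` G)) D) ->
    CSGL (Sequent ((x, y) |` T)%fset ((x, Box phi) +` G) D)
| FourL T G D x y phi :
    tree_sequent (Sequent ((x, y) |` T)%fset ((x, Box phi) +` G) D) ->
    CSGL (Sequent ((x, y) |` T)%fset ((x, Box phi) +` ((y, Box phi) +` G)) D) ->
    CSGL (Sequent ((x, y) |` T)%fset ((x, Box phi) +` G) D)
| BoxR T G D x y phi :
    tree_sequent (Sequent T G ((x, Box phi) +` D)) ->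
    ~ occurs y (Sequent T G ((x, Box phi) +` D)) ->
    CSGL (Sequent ((x, y) |` T)%fset ((y, Box phi) +` G) ((y, phi) +` D)) ->
    CSGL (Sequent T G ((x, Box phi) +` D)).

(* [S], the index of the proof, is the conclusion of its last rule instance. *)
Fixpoint end_active (S : sequent) (pi : CSGL S) : Prop :=
  match pi with
  | Id1 _ _ _ x _ _ => leaf S x
  | Id2 _ _ _ x _ _ => leaf S x
  | NegL _ _ _ x _ _ pi1 => leaf S x /\ end_active pi1
  | NegR _ _ _ x _ _ pi1 => leaf S x /\ end_active pi1
  | OrL _ _ _ x _ _ _ pi1 pi2 => [/\ leaf S x, end_active pi1 & end_active pi2]
  | OrR _ _ _ x _ _ _ pi1 => leaf S x /\ end_active pi1
  | BoxL _ _ _ x y _ _ pi1 => [/\ preleaf S x, leaf S y & end_active pi1]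
  | FourL _ _ _ x y _ _ pi1 => [/\ preleaf S x, leaf S y & end_active pi1]
  | BoxR _ _ _ _ _ _ _ _ pi1 => end_active pi1
  end.

(* Main.v *)
(** Soundness followed by completeness of a restricted proof search.  Every rule
    of CSGL preserves validity in transitive, conversely well-founded trees,
    where [BoxR] is Löb induction.  Conversely, search for a proof while only
    ever looking at one leaf [x]: decompose the formulae at [x] by local rules;
    then, for some [x : Box psi] on the right, create a fresh child [y] of [x]
    by [BoxR], copy each [x : Box chi] of the left to [y : chi] and
    [y : Box chi] by [BoxL] and [FourL], and continue at [y].  Such a proof is
    end-active, the search terminates because [Box psi] is a new boxed formula
    on the left, and a failed search yields a tree refuting the formulae at the
    current leaf. *)

Require Import Defs.
From mathcomp Require Import all_boot.
From mathcomp Require Import finmap multiset.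
From mathcomp Require Import zify.
From Stdlib Require Import Classical_Prop.

Set Implicit Arguments.
Unset Strict Implicit.
Unset Printing Implicit Defensive.

Local Open Scope fset_scope.
Local Open Scope mset_scope.

(** * Tree models and soundness *)

(** A world is identified with the tree that it generates. Being inductive, this type has no
    infinite descending branch, so converse well-foundedness is built in. The accessibility relation
    is the strict descendant relation [below]. *)
Inductive ktree : Type := KNode (V : nat -> Prop) (I : Type) (ch : I -> ktree).

Fixpoint below (u t : ktree) : Prop :=
  let: KNode _ _ ch := t in exists i, u = ch i \/ below u (ch i).

Definition valuation (t : ktree) : nat -> Prop := let: KNode V _ _ := t in V.

Fixpoint forces (t : ktree) (phi : form) : Prop :=
  match phi with
  | Var p => valuation t p
  | Neg a => ~ forces t a
  | Or a b => forces t a \/ forces t b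
  | Box a => forall u, below u t -> forces u a
  end.

Lemma below_trans t u v : below v u -> below u t -> below v t.
Proof.
move=> vu; elim: t => V I ch IH /= [i [uE|ut]]; exists i; right.
  by rewrite -uE.
exact: IH.
Qed.

(** Course-of-values induction along accessibility, the semantic form of Löb's principle. The
    structural induction proves [P] for all strict descendants of [t], and [step] then adds [t]
    itself. *)
Lemma below_ind (P : ktree -> Prop) :
  (forall t, (forall u, below u t -> P u) -> P t) -> forall t, P t.
Proof.
move=> step t; apply: (step); elim: t => V I ch IH u /= [i [->|]]; last exact: IH.
by apply: step; apply: IH.
Qed.

(** A relational atom may be sent to any strict descendant and not only to a child, since the
    witness against a boxed formula may lie at any depth. *)
Definition refutes (f : label -> ktree) (S : sequent) : Prop :=
  [/\ forall x y, edge (rels S) x y -> below (f y) (f x),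
      forall u, u \in antec S -> forces (f u.1) u.2
    & forall u, u \in succed S -> ~ forces (f u.1) u.2].

Lemma all_mset1D (P : lform -> Prop) u (G : {mset lform}) :
  P u -> (forall v, v \in G -> P v) -> forall v, v \in u +` G -> P v.
Proof. by move=> Pu PG v; rewrite in_mset1D => /predU1P[->|/PG]. Qed.

Lemma all_mset1D_inv (P : lform -> Prop) u (G : {mset lform}) :
  (forall v, v \in u +` G -> P v) -> P u /\ forall v, v \in G -> P v.
Proof.
by move=> PG; split=> [|v vG]; apply: PG; rewrite in_mset1D ?eqxx ?vG ?orbT.
Qed.

(** Read upwards, each rule passes a refutation of its conclusion on to one of its premises, and an
    identity leaves no refutation at all. *)
Theorem CSGL_sound S : CSGL S -> forall f, ~ refutes f S.
Proof.
elim=> {S} [T G D x p _|T G D x phi _|T G D x phi _ _ IH|T G D x phi _ _ IH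
  |T G D x phi psi _ _ IH1 _ IH2|T G D x phi psi _ _ IH|T G D x y phi _ _ IH
  |T G D x y phi _ _ IH|T G D x y phi _ fresh_y _ IH] f [/= fT fG fD].
- have [+ _] := all_mset1D_inv fD.
  by case: (all_mset1D_inv fG) => + _ => /[swap] /[apply].
- have [+ _] := all_mset1D_inv fD.
  by case: (all_mset1D_inv fG) => + _ => /[swap] /[apply].
- have [nf fG'] := all_mset1D_inv fG.
  by apply: (IH f); split=> //; apply: all_mset1D.
- have [nf fD'] := all_mset1D_inv fD.
  by apply: (IH f); split=> //; apply: all_mset1D => //; apply: NNPP.
- have [fo fG'] := all_mset1D_inv fG.
  case: fo => fo; [apply: (IH1 f)|apply: (IH2 f)]; split=> //;
    exact: all_mset1D.
- have [nf fD'] := all_mset1D_inv fD.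
  apply: (IH f); split=> //; apply: all_mset1D; last apply: all_mset1D => //.
    by move=> f1; apply: nf; left.
  by move=> f1; apply: nf; right.
- have [fb fG'] := all_mset1D_inv fG.
  apply: (IH f); split=> //; do 2![apply: all_mset1D => //].
  by apply: fb; apply: fT; rewrite /edge in_fset1U eqxx.
- have [fb fG'] := all_mset1D_inv fG.
  apply: (IH f); split=> //; do 2![apply: all_mset1D => //] => u uy.
  by apply: fb; apply: below_trans uy _; apply: fT; rewrite /edge in_fset1U eqxx.
- have [nf fD'] := all_mset1D_inv fD; apply: nf => /=.
  (* Löb induction on [u]: the induction hypothesis says that [Box phi] holds at [u]. If [phi]
     failed there, sending the fresh label [y] to [u] would refute the premise. *)
  elim/below_ind=> u IHu ux; apply: NNPP => nu.
  have yT z : edge T y z \/ edge T z y -> False.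
    by move=> yz; apply: fresh_y; left; exists z.
  have yF psi : (y, psi) \in G \/ (y, psi) \in (x, Box phi) +` D -> False.
    by move=> yz; apply: fresh_y; right; exists psi.
  have xy : (x == y) = false.
    apply/eqP=> xy; apply: (yF (Box phi)).
    by right; rewrite in_mset1D xy eqxx.
  pose g z := if z == y then u else f z.
  apply: (IH g); split=> /=.
  + move=> a b; rewrite /edge in_fset1U => /predU1P[[-> ->]|ab].
      by rewrite /g xy eqxx.
    rewrite /g; case: eqP => [E|_]; first by case: (yT a); right; rewrite -E.
    by case: eqP => [E|_]; [case: (yT b); left; rewrite -E|apply: fT].
  + apply: all_mset1D => [|[z psi] zG]; rewrite /g /= ?eqxx.
      by move=> v vu; apply: IHu => //; apply: below_trans vu ux.
    case: eqP => [E|_]; last exact: (fG (z, psi)).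
    by case: (yF psi); left; rewrite -E.
  + apply: all_mset1D => [|[z psi] zD]; rewrite /g /= ?eqxx //.
    case: eqP => [E|_]; last exact: (fD' (z, psi)).
    by case: (yF psi); right; rewrite in_mset1D -E zD orbT.
Qed.

(** * Growing a tree at a leaf *)

(** Unlike [is_tree], this counts the root as a node even when there are no relational atoms, so
    that the one-node tree can start an induction on growth. *)
Definition rooted (T : {fset relatom}) (r : label) : Prop :=
  forall v, vertex T v \/ v = r ->
    exists! p : seq label, path (edge T) r p /\ last r p = v.

(* [z] may label a formula of a tree sequent with relational atoms [T] in which
   [x] occurs. *)
Definition admissible (T : {fset relatom}) (x z : label) : Prop :=
  (T = fset0 /\ z = x) \/ vertex T z.

(** Leafhood stated for the relational atoms alone, so that it stays fixed while the formulae of the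
    sequent change. *)
Definition leaf_of (T : {fset relatom}) (x : label) : Prop :=
  [/\ is_tree T, admissible T x x & forall y, ~~ edge T x y].

Definition admissible_ctx (T : {fset relatom}) (x : label) (G : {mset lform}) :=
  forall u, u \in G -> admissible T x u.1.

Lemma vertex0 x : ~ vertex fset0 x.
Proof. by case=> y; rewrite /edge !in_fset0 => -[]. Qed.

Lemma edge_vertexl T x y : edge T x y -> vertex T x.
Proof. by move=> xy; exists y; left. Qed.

Lemma edge_vertexr T x y : edge T x y -> vertex T y.
Proof. by move=> xy; exists x; right. Qed.

Lemma edge1U T x y a b :
  edge ((x, y) |` T)%fset a b = ((a == x) && (b == y)) || edge T a b.
Proof. by rewrite /edge in_fset1U xpair_eqE. Qed.

Lemma vertex1U T x y z :
  vertex ((x, y) |` T)%fset z -> [\/ z = x, z = y | vertex T z].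
Proof.
case=> w; rewrite !edge1U => -[] /orP[/andP[/eqP ? /eqP ?]|zw].
- exact: Or31.
- by apply: Or33; apply: edge_vertexl zw.
- exact: Or32.
- by apply: Or33; apply: edge_vertexr zw.
Qed.

Lemma vertex_sub T x y z : vertex T z -> vertex ((x, y) |` T)%fset z.
Proof. by case=> w zw; exists w; rewrite !edge1U; case: zw => ->; rewrite !orbT; auto. Qed.

(** As [y] is new to [T], no edge leaves it, so a path can use the added edge only as its last
    step. *)
Lemma path1U T x y r p : r != y -> ~ vertex T y ->
  path (edge ((x, y) |` T)%fset) r p ->
  path (edge T) r p \/
  exists2 q, p = rcons q y & path (edge T) r q /\ last r q = x.
Proof.
move=> + yT; elim: p r => [|a p IH] r ry /=; first by left.
rewrite edge1U => /andP[/orP[/andP[/eqP rx /eqP ay]|ra] pp].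
  right; exists [::] => //=; subst a.
  case: p pp {IH} => //= b p /andP[]; rewrite edge1U => /orP[/andP[/eqP yx]|].
    by rewrite rx yx eqxx in ry.
  by move/edge_vertexl.
have ay : a != y by apply/eqP=> E; apply: yT; rewrite -E; apply: edge_vertexr ra.
case: (IH a ay pp) => [pT|[q -> [pq lq]]]; first by left; rewrite ra.
by right; exists (a :: q) => //=; rewrite ra.
Qed.

(** The only path to the new node [y] is the one to [x] followed by [y]; by [path1U] no other node
    gains a path. *)
Lemma rooted_extend T r x y : rooted T r -> vertex T x \/ x = r ->
  ~ vertex T y -> r != y -> rooted ((x, y) |` T)%fset r.
Proof.
move=> rT xT yT ry v vT'.
have subT : subrel (edge T) (edge ((x, y) |` T)%fset).
  by move=> a b ab; rewrite edge1U ab orbT.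
have lastN p : path (edge T) r p -> last r p <> y.
  case/lastP: p => [_ E|p a]; first by rewrite -E eqxx in ry.
  rewrite rcons_path last_rcons => /andP[_ /edge_vertexr aT] E.
  by apply: yT; rewrite -E.
have [->|vy] := eqVneq v y.
  have [p [[pT lp] up]] := rT x xT.
  exists (rcons p y); split.
    by rewrite rcons_path (sub_path subT pT) lp edge1U !eqxx last_rcons.
  move=> q [/(path1U ry yT)[qT|[q' -> [qT lq]]] lq'].
    by case: (lastN q).
  by rewrite (up q').
have {}vT' : vertex T v \/ v = r.
  case: vT' => [/vertex1U[->//|E|]|]; auto.
  by rewrite E eqxx in vy.
have [p [[pT lp] up]] := rT v vT'.
exists p; split; first by rewrite (sub_path subT pT).
move=> q [/(path1U ry yT)[qT|[q' -> [qT lq]]] lq']; first exact: up.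
by move: lq'; rewrite last_rcons => E; rewrite E eqxx in vy.
Qed.

Lemma rooted0 r : rooted fset0 r.
Proof.
move=> v [/vertex0//|->]; exists [::]; split=> // -[|a p] //=.
by case.
Qed.

Lemma leaf_of_extend T x y : leaf_of T x -> ~ vertex T y -> y != x ->
  leaf_of ((x, y) |` T)%fset y.
Proof.
case=> treeT xT xleaf yT yx.
have vy : vertex ((x, y) |` T)%fset y.
  by exists x; right; rewrite edge1U !eqxx.
have vx : vertex ((x, y) |` T)%fset x.
  by exists y; left; rewrite edge1U !eqxx.
split; last 2 first.
- by right.
- move=> z; rewrite edge1U (negbTE yx) /=.
  by apply/negP=> /edge_vertexl.
(* With no relational atoms yet, [x] becomes the root; otherwise the old root is kept. *)
right; case: treeT => [T0|[r rT uT]].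
  exists x => // v vT'; subst T.
  by apply: rooted_extend => //; [apply: rooted0|right|rewrite eq_sym|left].
have {}xT : vertex T x by case: xT => // -[T0]; subst T; case: (vertex0 rT).
exists r; first exact: vertex_sub.
move=> v vT'; apply: rooted_extend => //; try by left.
  by move=> w [wT|->]; apply: uT.
by apply/eqP=> E; apply: yT; rewrite -E.
Qed.

Lemma admissible_extend T x y z :
  admissible T x z -> admissible ((x, y) |` T)%fset y z.
Proof.
case=> [[_ ->]|zT]; right; last exact: vertex_sub.
by exists y; left; rewrite edge1U !eqxx.
Qed.

Lemma leaf_of_tree_sequent T x G D : leaf_of T x ->
  admissible_ctx T x G -> admissible_ctx T x D ->
  tree_sequent (Sequent T G D).
Proof.
case=> treeT _ _ aG aD.
have adm z : formula_label (Sequent T G D) z -> admissible T x z.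
  by case=> phi [/aG|/aD].
split=> //= [T0 z /adm[[]//|]|T0 y z /adm + /adm] //.
by case=> [[_ ->]|]; [case=> [[_ ->]//|]|]; rewrite T0 => /vertex0.
Qed.

Lemma leaf_of_leaf T x G D : leaf_of T x ->
  formula_label (Sequent T G D) x -> leaf (Sequent T G D) x.
Proof. by case=> _ _ xleaf xS; split=> //; right. Qed.

Lemma admissible_ctx1D T x G z phi : admissible T x z -> admissible_ctx T x G ->
  admissible_ctx T x ((z, phi) +` G).
Proof. by move=> zT GT; apply: all_mset1D. Qed.

(** * Derived rules for end-active proofs *)

(** Mere existence suffices, and it lets the search reason classically about provability. *)
Definition prov (S : sequent) : Prop := exists pi : CSGL S, end_active pi.

Lemma prov_NegL T G D x phi :
  tree_sequent (Sequent T ((x, Neg phi) +` G) D) ->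
  leaf (Sequent T ((x, Neg phi) +` G) D) x ->
  prov (Sequent T G ((x, phi) +` D)) -> prov (Sequent T ((x, Neg phi) +` G) D).
Proof. by move=> ts lx [pi ea]; exists (NegL ts pi). Qed.

Lemma prov_NegR T G D x phi :
  tree_sequent (Sequent T G ((x, Neg phi) +` D)) ->
  leaf (Sequent T G ((x, Neg phi) +` D)) x ->
  prov (Sequent T ((x, phi) +` G) D) -> prov (Sequent T G ((x, Neg phi) +` D)).
Proof. by move=> ts lx [pi ea]; exists (NegR ts pi). Qed.

Lemma prov_OrL T G D x phi psi :
  tree_sequent (Sequent T ((x, Or phi psi) +` G) D) ->
  leaf (Sequent T ((x, Or phi psi) +` G) D) x ->
  prov (Sequent T ((x, phi) +` G) D) -> prov (Sequent T ((x, psi) +` G) D) ->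
  prov (Sequent T ((x, Or phi psi) +` G) D).
Proof. by move=> ts lx [pi1 ea1] [pi2 ea2]; exists (OrL ts pi1 pi2). Qed.

Lemma prov_OrR T G D x phi psi :
  tree_sequent (Sequent T G ((x, Or phi psi) +` D)) ->
  leaf (Sequent T G ((x, Or phi psi) +` D)) x ->
  prov (Sequent T G ((x, phi) +` ((x, psi) +` D))) ->
  prov (Sequent T G ((x, Or phi psi) +` D)).
Proof. by move=> ts lx [pi ea]; exists (OrR ts pi). Qed.

Definition literal (phi : form) : bool :=
  match phi with Var _ | Box _ => true | _ => false end.

Lemma prov_id T G D x phi : literal phi ->
  (x, phi) \in G -> (x, phi) \in D ->
  tree_sequent (Sequent T G D) -> leaf (Sequent T G D) x ->
  prov (Sequent T G D).
Proof.
move=> lit xG xD; rewrite -(msetB1K xG) -(msetB1K xD) => ts lx.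
by case: phi lit ts lx {xG xD} => //= phi _ ts lx; [exists (Id1 ts)|exists (Id2 ts)].
Qed.

Lemma prov_BoxL T G D x y phi : edge T x y -> (x, Box phi) \in G ->
  tree_sequent (Sequent T G D) -> preleaf (Sequent T G D) x ->
  leaf (Sequent T G D) y ->
  prov (Sequent T ((y, phi) +` G) D) -> prov (Sequent T G D).
Proof.
(* The atom already lies in [T]; inserting it again gives [T] the shape that the rule asks for. *)
move=> xy xG; have -> : T = ((x, y) |` T)%fset.
  by apply/fsetP=> u; rewrite in_fset1U; case: eqP => // ->.
rewrite -(msetB1K xG) msetDCA => ts px ly [pi ea].
by exists (BoxL ts pi).
Qed.

Lemma prov_FourL T G D x y phi : edge T x y -> (x, Box phi) \in G ->
  tree_sequent (Sequent T G D) -> preleaf (Sequent T G D) x ->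
  leaf (Sequent T G D) y ->
  prov (Sequent T ((y, Box phi) +` G) D) -> prov (Sequent T G D).
Proof.
move=> xy xG; have -> : T = ((x, y) |` T)%fset.
  by apply/fsetP=> u; rewrite in_fset1U; case: eqP => // ->.
rewrite -(msetB1K xG) msetDCA => ts px ly [pi ea].
by exists (FourL ts pi).
Qed.

Lemma prov_BoxR T G D x y phi :
  tree_sequent (Sequent T G ((x, Box phi) +` D)) ->
  ~ occurs y (Sequent T G ((x, Box phi) +` D)) ->
  prov (Sequent ((x, y) |` T)%fset ((y, Box phi) +` G) ((y, phi) +` D)) ->
  prov (Sequent T G ((x, Box phi) +` D)).
Proof. by move=> ts fy [pi ea]; exists (BoxR ts fy pi). Qed.

Definition adds (x : label) (s : seq form) (G : {mset lform}) : {mset lform} :=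
  foldr (fun phi H => (x, phi) +` H) G s.

Lemma adds1D x s u G : adds x s (u +` G) = u +` adds x s G.
Proof. by elim: s => //= phi s ->; rewrite msetDCA. Qed.

Lemma addsC x s t G : adds x s (adds x t G) = adds x t (adds x s G).
Proof. by elim: s => //= phi s ->; rewrite adds1D. Qed.

Lemma mem_adds x s G phi : phi \in s -> (x, phi) \in adds x s G.
Proof.
elim: s => //= psi s IH; rewrite inE in_mset1D => /predU1P[->|/IH->].
  by rewrite eqxx.
by rewrite orbT.
Qed.

Lemma admissible_ctx_adds T x z s G : admissible T x z -> admissible_ctx T x G ->
  admissible_ctx T x (adds z s G).
Proof. by move=> zT GT; elim: s => //= phi s IH; apply: admissible_ctx1D. Qed.

(** One [BoxL] and one [FourL] per element of [s], both of which keep their principal formula. As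
    [y] is a leaf and the only child of [x], the label [x] is a pre-leaf, which makes these
    instances end-active. *)
Lemma prov_propagate T x y G D s : leaf_of T y -> edge T x y ->
  (forall z, edge T x z -> z = y) ->
  admissible_ctx T y G -> admissible_ctx T y D ->
  (forall chi, chi \in s -> (x, Box chi) \in G) ->
  prov (Sequent T (adds y (map Box s) (adds y s G)) D) -> prov (Sequent T G D).
Proof.
move=> yleaf xy xuniq + aD.
have ly G' : leaf (Sequent T G' D) y.
  by case: yleaf => _ _ yl; split=> //; left; apply: edge_vertexr xy.
have px G' : preleaf (Sequent T G' D) x.
  by split=> [|z /xuniq->//]; left; apply: edge_vertexl xy.
have yT : admissible T y y by case: yleaf.
elim: s G => [|chi s IH] G aG sG //= pr.
have xG : (x, Box chi) \in G by apply: sG; rewrite inE eqxx.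
have ts G' : admissible_ctx T y G' -> tree_sequent (Sequent T G' D).
  by move=> aG'; apply: leaf_of_tree_sequent yleaf aG' aD.
have aG1 : admissible_ctx T y ((y, chi) +` G) by apply: admissible_ctx1D.
apply: (prov_BoxL xy xG) => //; first exact: ts.
have xG1 : (x, Box chi) \in (y, chi) +` G by rewrite in_mset1D xG orbT.
apply: (prov_FourL xy xG1) => //; first exact: ts.
apply: IH => [|psi ps|]; first exact: admissible_ctx1D.
  by rewrite !in_mset1D sG ?orbT // inE ps orbT.
by rewrite !adds1D; rewrite adds1D in pr.
Qed.

Lemma fresh_label S : exists y, ~ occurs y S.
Proof.
pose s := [seq u.1 | u <- rels S] ++ [seq u.2 | u <- rels S] ++
  [seq u.1 | u <- finsupp (antec S)] ++ [seq u.1 | u <- finsupp (succed S)].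
(* The successor of the sum of all labels in use exceeds each of them. *)
exists (sumn s).+1 => yS.
have : (sumn s).+1 \in s.
  rewrite !mem_cat; case: yS => [[z [zy|zy]]|[phi [yG|yD]]]; apply/or4P.
  - by apply: Or41; apply/mapP; exists ((sumn s).+1, z).
  - by apply: Or42; apply/mapP; exists (z, (sumn s).+1).
  - by apply: Or43; apply/mapP; exists ((sumn s).+1, phi); rewrite ?msuppE.
  - by apply: Or44; apply/mapP; exists ((sumn s).+1, phi); rewrite ?msuppE.
suff le_sumn (t : seq nat) n : n \in t -> n <= sumn t.
  by move/le_sumn; rewrite ltnn.
elim: t => //= a t IH; rewrite inE => /predU1P[->|/IH nt]; first exact: leq_addr.
exact: leq_trans nt (leq_addl _ _).
Qed.

(** * Proof search at a leaf *)

Definition refutable (L R : seq form) : Prop :=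
  exists t, (forall phi, phi \in L -> forces t phi) /\
            (forall phi, phi \in R -> ~ forces t phi).

Definition subformula_closed (s : seq form) : Prop :=
  forall phi, phi \in s ->
    match phi with
    | Var _ => True
    | Neg a | Box a => a \in s
    | Or a b => a \in s /\ b \in s
    end.

Fixpoint subformulas (phi : form) : seq form :=
  phi :: match phi with
         | Var _ => [::]
         | Neg a | Box a => subformulas a
         | Or a b => subformulas a ++ subformulas b
         end.

Lemma subformulas_refl phi : phi \in subformulas phi.
Proof. by case: phi => *; rewrite inE eqxx. Qed.

Lemma subformulas_closed phi : subformula_closed (subformulas phi).
Proof.
elim: phi => [p|a IH|a IHa b IHb|a IH] psi /=; rewrite in_cons => /predU1P[->|] //.
- by rewrite inE subformulas_refl orbT.
- by move/IH; case: psi => // [c|c d|c]; rewrite !inE;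
     [move=> ->|case=> -> ->|move=> ->]; rewrite !orbT.
- by rewrite !inE !mem_cat !subformulas_refl !orbT.
- by rewrite mem_cat => /orP[/IHa|/IHb]; case: psi => // [c|c d|c];
     rewrite !inE !mem_cat; (try case); move=> -> *; rewrite ?orbT //;
     split; rewrite ?orbT //; apply/or3P; auto using Or32, Or33.
- by rewrite inE subformulas_refl orbT.
- by move/IH; case: psi => // [c|c d|c]; rewrite !inE;
     [move=> ->|case=> -> ->|move=> ->]; rewrite !orbT.
Qed.

Fixpoint fsize (phi : form) : nat :=
  match phi with
  | Var _ => 1
  | Neg a | Box a => (fsize a).+1
  | Or a b => (fsize a + fsize b).+1
  end.

Lemma fsize_gt0 phi : 0 < fsize phi.
Proof. by case: phi. Qed.

Definition weight (s : seq form) : nat := sumn (map fsize s).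

Lemma refutable_sub L R L' R' : {subset L' <= L} -> {subset R' <= R} ->
  refutable L R -> refutable L' R'.
Proof.
move=> sL sR [t [tL tR]]; exists t.
by split=> phi => [/sL/tL|/sR/tR].
Qed.

Lemma all_cons (P : form -> Prop) a s :
  P a -> (forall phi, phi \in s -> P phi) -> forall phi, phi \in a :: s -> P phi.
Proof. by move=> Pa Ps phi; rewrite inE => /predU1P[->|/Ps]. Qed.

Lemma all_cons_inv (P : form -> Prop) a s :
  (forall phi, phi \in a :: s -> P phi) -> P a /\ forall phi, phi \in s -> P phi.
Proof. by move=> Ps; split=> [|phi ps]; apply: Ps; rewrite inE ?eqxx ?ps ?orbT. Qed.

Lemma subset_cons (a : form) (s t : seq form) :
  a \in t -> {subset s <= t} -> {subset a :: s <= t}.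
Proof. by move=> at_ st phi; rewrite inE => /predU1P[->|/st]. Qed.

(** [L] and [R] are the formulae at [x] still to be treated, while [A] and [B] accumulate the
    literals found. The induction is on the total size of [L] and [R], and it works because the
    local rules are invertible: a tree refuting a premise refutes the conclusion. The lower bound
    [A0] records that no literal on the left is lost, on which the termination of [search]
    relies. *)
Lemma local_search T x G D (sig A0 : seq form) :
  subformula_closed sig -> leaf_of T x ->
  admissible_ctx T x G -> admissible_ctx T x D ->
  (forall A B : seq form, all literal A -> all literal B ->
     {subset A <= sig} -> {subset B <= sig} -> {subset A0 <= A} ->
     prov (Sequent T (adds x A G) (adds x B D)) \/ refutable A B) ->
  forall L R A B : seq form, all literal A -> all literal B ->
    {subset L <= sig} -> {subset R <= sig} ->
    {subset A <= sig} -> {subset B <= sig} -> {subset A0 <= A} ->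
    prov (Sequent T (adds x L (adds x A G)) (adds x R (adds x B D))) \/
    refutable (L ++ A) (R ++ B).
Proof.
move=> sigP xleaf aG aD Hsat L R.
have [m] := ubnP (weight L + weight R); elim: m L R => // m IH L R ltm A B lA lB.
have xT : admissible T x x by case: xleaf.
have ts L' R' : tree_sequent
    (Sequent T (adds x L' (adds x A G)) (adds x R' (adds x B D))).
  by apply: leaf_of_tree_sequent xleaf _ _; do 2![apply: admissible_ctx_adds => //].
have lx G' D' phi : (x, phi) \in G' \/ (x, phi) \in D' -> leaf (Sequent T G' D') x.
  by move=> xS; apply: leaf_of_leaf => //; exists phi.
case: L ltm => [|phi L] ltm sL sR sA sB sA0.
  case: R ltm sR => [|phi R] ltm sR; first exact: Hsat.
  have /sR phi_sig : phi \in phi :: R by rewrite inE eqxx.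
  have {}sR : {subset R <= sig} by move=> a aR; apply: sR; rewrite inE aR orbT.
  have {}lx := lx (adds x A G) ((x, phi) +` adds x R (adds x B D)) phi
    (or_intror (mset1D1 _ _)).
  have {}ts := ts [::] (phi :: R).
  (* A literal moves to the accumulator without any rule; the size drops because [fsize] is
     positive. *)
  case: (boolP (literal phi)) => [lphi|].
    have [||||||||pr|ref] := IH [::] R _ A (phi :: B); rewrite /= ?lphi //.
    - by have := fsize_gt0 phi; rewrite /weight /= in ltm *; lia.
    - exact: subset_cons.
    - by left; rewrite /= adds1D in pr.
    - by right; apply: refutable_sub ref => // a; rewrite /= !(inE, mem_cat) orbCA.
  case: phi ltm phi_sig lx ts => //= [a|a b] ltm /sigP phi_sig lx ts _.
    have [||||||||pr|[t [tL tR]]] := IH [:: a] R _ A B; rewrite //=.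
    - by rewrite /weight /= in ltm *; lia.
    - exact: subset_cons.
    - by left; apply: prov_NegR.
    right; exists t; have [ta tA] := all_cons_inv tL.
    by split=> //; apply: all_cons => //=; apply.
  case: phi_sig => a_sig b_sig.
  have [||||||||pr|[t [tL tR]]] := IH [::] [:: a, b & R] _ A B; rewrite //=.
  - by rewrite /weight /= in ltm *; lia.
  - by do 2![apply: subset_cons => //].
  - by left; apply: prov_OrR.
  right; exists t; have [ta /all_cons_inv[tb tR']] := all_cons_inv tR.
  by split=> //; apply: all_cons => //= -[].
have /sL phi_sig : phi \in phi :: L by rewrite inE eqxx.
have {}sL : {subset L <= sig} by move=> a aL; apply: sL; rewrite inE aL orbT.
have {}lx := lx ((x, phi) +` adds x L (adds x A G)) (adds x R (adds x B D)) phi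
  (or_introl (mset1D1 _ _)).
have {}ts := ts (phi :: L) R.
case: (boolP (literal phi)) => [lphi|].
  have [||||||||pr|ref] := IH L R _ (phi :: A) B; rewrite /= ?lphi //.
  - by have := fsize_gt0 phi; rewrite /weight /= in ltm *; lia.
  - exact: subset_cons.
  - by move=> a /sA0 aA; rewrite inE aA orbT.
  - by left; rewrite /= adds1D in pr.
  - by right; apply: refutable_sub ref => // a; rewrite /= !(inE, mem_cat) orbCA.
case: phi ltm phi_sig lx ts => //= [a|a b] ltm /sigP phi_sig lx ts _.
  have [||||||||pr|[t [tL tR]]] := IH L (a :: R) _ A B; rewrite //=.
  - by rewrite /weight /= in ltm *; lia.
  - exact: subset_cons.
  - by left; apply: prov_NegL.
  right; exists t; have [ta tR'] := all_cons_inv tR.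
  by split=> //; apply: all_cons.
case: phi_sig => a_sig b_sig.
have [||||||||pra|[t [tL tR]]] := IH (a :: L) R _ A B; rewrite //=.
- by rewrite /weight /= in ltm *; lia.
- exact: subset_cons.
- have [||||||||prb|[t [tL tR]]] := IH (b :: L) R _ A B; rewrite //=.
  + by rewrite /weight /= in ltm *; lia.
  + exact: subset_cons.
  + by left; apply: prov_OrL.
  right; exists t; have [tb tL'] := all_cons_inv tL.
  by split=> //; apply: all_cons => //; right.
right; exists t; have [ta tL'] := all_cons_inv tL.
by split=> //; apply: all_cons => //; left.
Qed.

(** * Boxed formulae and the passage to a child *)

Definition is_box (phi : form) : bool := if phi is Box _ then true else false.

Definition unbox (s : seq form) : seq form :=
  pmap (fun phi => if phi is Box a then Some a else None) s.

Lemma mem_unbox a s : (a \in unbox s) = (Box a \in s).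
Proof.
elim: s => //= phi s IH; rewrite in_cons -IH.
case: phi => [p|b|b c|b] //=; rewrite in_cons; congr (_ || _).
by apply/eqP/eqP=> [->|[]].
Qed.

Lemma count_ltn (U : eqType) (p q : pred U) (s : seq U) z :
  subpred p q -> z \in s -> q z -> ~~ p z -> count p s < count q s.
Proof.
move=> pq + qz pz; elim: s => //= a s IH; rewrite inE => /predU1P[<-|/IH lt].
  by rewrite qz (negbTE pz) add0n add1n ltnS sub_count.
have : p a <= q a by case: (boolP (p a)) => // /pq ->.
by lia.
Qed.

(** Choice over a finite list, by induction on the list; [w0] is the value of the function for the
    empty list. *)
Lemma choice_in (U : eqType) (W : Type) (w0 : W) (P : U -> W -> Prop) (s : seq U) :
  (forall a, a \in s -> exists w, P a w) ->
  exists f : U -> W, forall a, a \in s -> P a (f a).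
Proof.
elim: s => [|b s IH] Ps; first by exists (fun=> w0).
have [|f fP] := IH; first by move=> a as_; apply: Ps; rewrite inE as_ orbT.
have [|w wP] := Ps b; first by rewrite inE eqxx.
exists (fun a => if a == b then w else f a) => a.
by rewrite inE; case: eqP => [->|_ /fP].
Qed.

(** The tree has a root at which exactly the variables of [A] hold and one child for each [Box psi]
    in [B], namely a tree refuting [psi]. A box of [A] holds at the root because each child forces
    both its body and the box itself, the latter taking care of deeper nodes. *)
Lemma refutable_jump A B : all literal A -> all literal B ->
  ~~ has (mem B) A ->
  (forall psi, psi \in unbox B ->
     refutable (unbox A ++ [seq Box chi | chi <- unbox A]) [:: psi]) ->
  refutable A B.
Proof.
move=> /allP lA /allP lB /hasPn disj ref.
(* A default value for [choice_in]; any tree would do. *)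
have leaf0 : ktree := KNode (fun=> True) (of_void ktree).
have [ch chP] := choice_in leaf0 ref.
exists (@KNode (fun p => Var p \in A) {psi | psi \in unbox B} (fun i => ch (val i))).
split=> [[p|a|a b|a] aA|[p|a|a b|a] aB] //=; try by have := lA _ aA.
- move=> u [[psi psiB] /= [->|u_psi]]; have [chA _] := chP psi psiB.
    by apply: chA; rewrite mem_cat mem_unbox aA.
  have: forces (ch psi) (Box a); last exact.
  by apply: chA; rewrite mem_cat map_f ?orbT // mem_unbox.
- by move/disj; rewrite /= aB.
- by have := lB _ aB.
- by have := lB _ aB.
- have aB' : a \in unbox B by rewrite mem_unbox.
  have [_ chB] := chP a aB'; move/(_ (ch a)) => fa.
  apply: (chB a); first by rewrite inE.
  by apply: fa; exists (exist _ a aB'); left.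
Qed.

(** The measure counts the boxed formulae of [sig] that are not yet among the left literals of the
    current leaf. Local steps do not increase it, and each passage to a child lowers it. *)
Lemma search (sig : seq form) n : subformula_closed sig ->
  forall T x G D (L R A B : seq form), leaf_of T x ->
  admissible_ctx T x G -> admissible_ctx T x D ->
  all literal A -> all literal B ->
  {subset L <= sig} -> {subset R <= sig} ->
  {subset A <= sig} -> {subset B <= sig} ->
  count (fun b => is_box b && (b \notin A)) sig < n ->
  prov (Sequent T (adds x L (adds x A G)) (adds x R (adds x B D))) \/
  refutable (L ++ A) (R ++ B).
Proof.
move=> sigP; elim: n => // n IH T x G D L R A0 B0 xleaf aG aD lA0 lB0 sL sR sA0 sB0 ltn.
apply: (local_search (A0 := A0) sigP) => // A B lA lB sA sB A0A.
have {}ltn : count (fun b => is_box b && (b \notin A)) sig <= n.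
  rewrite -ltnS; apply: leq_trans ltn; rewrite ltnS; apply: sub_count => b /andP[-> bA] /=.
  by apply: contra bA => /A0A.
have xT : admissible T x x by case: (xleaf).
have aGA : admissible_ctx T x (adds x A G) by apply: admissible_ctx_adds.
have aDB : admissible_ctx T x (adds x B D) by apply: admissible_ctx_adds.
have ts := leaf_of_tree_sequent xleaf aGA aDB.
case: (boolP (has (mem B) A)) => [/hasP[phi phiA phiB]|disj].
  left; apply: (prov_id (phi := phi) (x := x)) => //; try exact: mem_adds.
    exact: (allP lA).
  by apply: leaf_of_leaf => //; exists phi; left; apply: mem_adds.
(* If the sequent is unprovable, the search at a child must fail for every [Box psi] of [B], so all
   the refuting trees needed by [refutable_jump] are available at once. *)
case: (classic (prov (Sequent T (adds x A G) (adds x B D)))) => [|npr]; first by left.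
right; apply: refutable_jump => // psi; rewrite mem_unbox => psiB.
have psiA : Box psi \notin A by apply: contraNN disj => psiA; apply/hasP; exists (Box psi).
have [y fresh_y] := fresh_label (Sequent T (adds x A G) (adds x B D)).
have xpsi : (x, Box psi) \in adds x B D by apply: mem_adds.
have yT : ~ vertex T y by move=> yT; apply: fresh_y; left.
have yx : y != x.
  by apply/eqP=> yx; apply: fresh_y; right; exists (Box psi); right; rewrite yx.
have yleaf := leaf_of_extend xleaf yT yx.
have ext H : admissible_ctx T x H -> admissible_ctx ((x, y) |` T)%fset y H.
  by move=> aH u /aH; apply: admissible_extend.
set D1 := adds x B D `\ (x, Box psi).
have aD1 : admissible_ctx ((x, y) |` T)%fset y D1.
  by move=> u; rewrite in_msetB1 => /andP[_ /(ext _ aDB)].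
have psi_sig : psi \in sig by have := sigP _ (sB _ psiB).
have yy : admissible ((x, y) |` T)%fset y y by case: (yleaf).
(* At [y] all formulae of the older labels become passive context. The boxes count as left literals
   from the start, and only the bodies and [psi] remain to be decomposed. *)
have [|||||||||pr|ref] := IH _ y (adds x A G) D1 (unbox A) [:: psi]
  (Box psi :: map Box (unbox A)) [::] yleaf; rewrite //=.
- exact: ext.
- by apply/allP=> phi /mapP[chi _ ->].
- by move=> chi; rewrite mem_unbox => /sA/sigP.
- by move=> chi; rewrite inE => /eqP->.
- apply: subset_cons; first exact: sB.
  by move=> phi /mapP[chi]; rewrite mem_unbox => /sA ? ->.
(* [Box psi] leaves the count: it was not in [A], since [A] and [B] are disjoint, and it is a left
   literal at [y]. All boxes of [A] are carried over, so none re-enters. *)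
- apply: leq_trans ltn; apply: (count_ltn (z := Box psi)) => //=; last 2 first.
  + exact: sB.
  + by rewrite inE eqxx.
  move=> [p|a|a b|a] //=; rewrite inE negb_or => /andP[_].
  by apply: contra => aA; apply: map_f; rewrite mem_unbox.
(* A proof found at [y] would yield one at [x], by [BoxR] below the propagation steps. *)
- case: npr; rewrite -(msetB1K xpsi) in ts fresh_y *.
  apply: prov_BoxR ts fresh_y _.
  apply: (prov_propagate (x := x) (s := unbox A) yleaf).
  + by rewrite edge1U !eqxx.
  + move=> z; rewrite edge1U eqxx /= => /orP[/eqP//|xz].
    by case: xleaf => _ _ /(_ z); rewrite xz.
  + by apply: admissible_ctx1D => //; apply: ext.
  + exact: admissible_ctx1D.
  + by move=> chi; rewrite mem_unbox in_mset1D => chiA; rewrite mem_adds ?orbT.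
  by rewrite addsC !adds1D; rewrite /= adds1D in pr.
(* The tree found for [y] also forces the diagonal formula [Box psi], which is forgotten here. *)
- apply: refutable_sub ref => // phi; rewrite !(mem_cat, inE).
  by case/orP=> ->; rewrite ?orbT.
Qed.

Theorem theorem4p6 (x : label) (phi : form)
    (pi : CSGL (Sequent fset0 mset0 (msetn 1 (x, phi)))) :
  exists pi' : CSGL (Sequent fset0 mset0 (msetn 1 (x, phi))), end_active pi'.
Proof.
have xleaf : leaf_of fset0 x.
  by split=> [||y]; [left|left|rewrite /edge in_fset0].
have ctx0 : admissible_ctx fset0 x mset0 by move=> u; rewrite in_mset0.
(* The count is at most the length of the list of subformulae, and the successor makes the bound
   strict. *)
have [|||||||pr|[t [_ tphi]]] := search (n := (size (subformulas phi)).+1)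
  (@subformulas_closed phi) (L := [::]) (R := [:: phi]) (A := [::]) (B := [::])
  xleaf ctx0 ctx0; rewrite //=.
- by move=> psi; rewrite inE => /eqP->; apply: subformulas_refl.
- by rewrite ltnS count_size.
- by rewrite /= msetD0 in pr.
(* The given proof enters only here: by soundness it excludes the tree [t] left by a failed search.
   There are no relational atoms, so every label may be sent to [t]. *)
case: (CSGL_sound pi (f := fun=> t)); split=> /= [a b|u|u].
- by rewrite /edge in_fset0.
- by rewrite in_mset0.
- by rewrite in_mset1 => /eqP->; apply: tphi; rewrite inE.
Qed.
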